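(* Let $(M,h)$ be a Riemannian manifold of dimension $n\ge3$ and let $g_+$ be an even Poincaré metric in normal form relative to $h$ on $M_+^\circ$. Let $\nu\in\frac n2+i\mathbb R$, $\nu\ne\frac n2$, and let $u\in C^\infty(M_+^\circ)$ be a solution of $$\Delta_{g_+}u+\nu(n-\nu)u=0$$ with boundary value $f\in C^\infty(M)$. For $\lambda\in\mathbb C$ let $M_u(r;\lambda)=r^{\lambda-n+1}u\in C^\infty(M_+^\circ)$, and let $M_r$ denote the operator of multiplication by $r$. Then $$M_r(M_u(r;\lambda))=M_u(r;\lambda+1),$$ $$S(g_+;\lambda)(M_u(r;\lambda))=(\lambda+\nu-n+1)(\nu-\lambda-1)\,M_u(r;\lambda-1).$$
   Context: Setting. $M_+=[0,\varepsilon)\times M$ with coordinate $r$ on the first factor, $M_+^\circ=(0,\varepsilon)\times M$, $\iota:M\to M_+$, $\iota(m)=(0,m)$. An even Poincaré metric in normal form relative to $h$ is a metric $g_+=r^{-2}(dr^2+h_r)$ on $M_+^\circ$, where $h_r$ is a one-parameter family of metrics on $M$, smooth up to $r=0$, with $h_0=h$ and with only even powers of $r$ in its Taylor series at $r=0$, such that: for odd $n$, $\operatorname{Ric}(g_+)+ng_+=O(r^\infty)$; for even $n$, $\operatorname{Ric}(g_+)+ng_+=O(r^{n-2})$ and $\operatorname{tr}_h(\iota^*(r^{-n+2}(\operatorname{Ric}(g_+)+ng_+)))=0$. Put $\bar g=r^2g_+=dr^2+h_r$. Laplacians are non-positive: $\Delta=-\delta d$. The shift operator is $S(g_+;\lambda)=r\Delta_{\bar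 g}-(2\lambda-n+1)\partial_r-\frac12(\lambda-n+1)\operatorname{tr}(h_r^{-1}\dot h_r)$ (dot $=\partial/\partial r$), acting on $C^\infty(M_+^\circ)$. Boundary value: $u$ has the form $u=r^\nu G+r^{n-\nu}F$ with $F,G\in C^\infty(M_+)$, and its boundary value is the restriction to $r=0$ of the coefficient $F$, i.e. $f=\iota^*(F)$. *)

(* Defs.v *)
From HB Require Import structures.
From mathcomp Require Import all_boot all_order all_algebra.
From mathcomp Require Import all_classical all_reals all_analysis.
From mathcomp Require Import complex.

Set Implicit Arguments.
Unset Strict Implicit.
Unset Printing Implicit Defensive.

Import Order.TTheory GRing.Theory Num.Theory.
Import numFieldNormedType.Exports.

Local Open Scope ring_scope.
Local Open Scope complex_scope.
Local Open Scope classical_set_scope.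

(** * Smooth functions on subsets of R^m *)

Definition pd (R : realType) (m : nat) (a : 'I_m) (f : 'rV[R]_m -> R)
  (x : 'rV[R]_m) : R := 'D_(delta_mx 0 a) f x.

Definition iter_pd (R : realType) (m : nat) (s : seq 'I_m)
  (f : 'rV[R]_m -> R) : 'rV[R]_m -> R := foldr (@pd R m) f s.

(* Meant for an open [W]. *)
Definition smooth_open (R : realType) (m : nat) (W : set 'rV[R]_m)
  (f : 'rV[R]_m -> R) : Prop :=
  forall (s : seq 'I_m) x, W x ->
    {for x, continuous (iter_pd s f)} /\
    forall a : 'I_m, derivable (iter_pd s f) x (delta_mx 0 a).

(* For an arbitrary [A]: local existence of smooth extensions.  On subsets of
   a half space this is smoothness up to the boundary; on open sets it agrees
   with [smooth_open]. *)
Definition smooth (R : realType) (m : nat) (A : set 'rV[R]_m)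
  (f : 'rV[R]_m -> R) : Prop :=
  forall x, A x -> exists (W : set 'rV[R]_m) (F : 'rV[R]_m -> R),
    [/\ open W, W x, smooth_open W F & forall y, W y -> A y -> f y = F y].

Definition smoothC (R : realType) (m : nat) (A : set 'rV[R]_m)
  (f : 'rV[R]_m -> R[i]) : Prop :=
  smooth A (fun x => complex.Re (f x)) /\ smooth A (fun x => complex.Im (f x)).

Definition smooth_mx (R : realType) (m p q : nat) (A : set 'rV[R]_m)
  (f : 'rV[R]_m -> 'M[R]_(p, q)) : Prop :=
  forall i j, smooth A (fun x => f x i j).

(** * Riemannian geometry in coordinates

   [G : 'rV_m -> 'M_m] is the field of components of a metric. *)

(* [christoffel G a b c x] is Gamma^c_ab. *)
Definition christoffel (R : realType) (m : nat) (G : 'rV[R]_m -> 'M[R]_m)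
  (a b c : 'I_m) (x : 'rV[R]_m) : R :=
  2^-1 * \sum_(d < m) invmx (G x) c d *
    (pd a (fun y => G y b d) x + pd b (fun y => G y a d) x
     - pd d (fun y => G y a b) x).

(* Sign convention: the Ricci tensor of the round sphere is positive. *)
Definition ricci (R : realType) (m : nat) (G : 'rV[R]_m -> 'M[R]_m)
  (x : 'rV[R]_m) : 'M[R]_m :=
  let Gam := christoffel G in
  \matrix_(b, c) \sum_(a < m)
    (pd a (Gam b c a) x - pd c (Gam b a a) x
     + \sum_(d < m) (Gam a d a x * Gam b c d x - Gam c d a x * Gam b a d x)).

Definition pdC (R : realType) (m : nat) (a : 'I_m) (f : 'rV[R]_m -> R[i])
  (x : 'rV[R]_m) : R[i] :=
  pd a (fun y => complex.Re (f y)) x +i* pd a (fun y => complex.Im (f y)) x.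

(* The component (nabla_a w)_b of the Levi-Civita derivative of a 1-form. *)
Definition cov_deriv (R : realType) (m : nat) (G : 'rV[R]_m -> 'M[R]_m)
  (w : 'I_m -> 'rV[R]_m -> R[i]) (a b : 'I_m) (x : 'rV[R]_m) : R[i] :=
  pdC a (w b) x - \sum_(c < m) (christoffel G a b c x)%:C * w c x.

Definition codiff (R : realType) (m : nat) (G : 'rV[R]_m -> 'M[R]_m)
  (w : 'I_m -> 'rV[R]_m -> R[i]) (x : 'rV[R]_m) : R[i] :=
  - \sum_(a < m) \sum_(b < m) (invmx (G x) a b)%:C * cov_deriv G w a b x.

Definition laplace (R : realType) (m : nat) (G : 'rV[R]_m -> 'M[R]_m)
  (f : 'rV[R]_m -> R[i]) (x : 'rV[R]_m) : R[i] :=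
  - codiff G (fun a => pdC a f) x.

(** * Manifolds *)

(* Only the values of [cmap] on [cdom] and of [cinv] on [cmap @` cdom]
   matter. *)
Record chart (R : realType) (n : nat) (T : topologicalType) := Chart {
  cdom : set T;
  cmap : T -> 'rV[R]_n;
  cinv : 'rV[R]_n -> T;
  cdom_open : open cdom;
  cimg_open : open (cmap @` cdom);
  cmapK : forall p, cdom p -> cinv (cmap p) = p;
  cmap_continuous : forall p, cdom p -> {for p, continuous cmap};
  cinv_continuous : forall x, (cmap @` cdom) x -> {for x, continuous cinv} }.

Definition cimg (R : realType) (n : nat) (T : topologicalType)
  (c : chart R n T) : set 'rV[R]_n := cmap c @` cdom c.

Definition transition (R : realType) (n : nat) (T : topologicalType)
  (c c' : chart R n T) (x : 'rV[R]_n) : 'rV[R]_n := cmap c' (cinv c x).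

Definition overlap (R : realType) (n : nat) (T : topologicalType)
  (c c' : chart R n T) : set 'rV[R]_n := cmap c @` (cdom c `&` cdom c').

(* Smooth manifolds without boundary, given by an arbitrary smooth atlas. *)
Record manifold (R : realType) (n : nat) := Manifold {
  mpoint :> topologicalType;
  mindex : Type;
  atlas : mindex -> chart R n mpoint;
  atlas_cover : forall p, exists k, cdom (atlas k) p;
  transition_smooth : forall k l,
    smooth_mx (overlap (atlas k) (atlas l)) (transition (atlas k) (atlas l));
  manifold_hausdorff : hausdorff_space mpoint;
  manifold_second_countable : @second_countable mpoint }.

Arguments atlas [R n] m _.

Definition smooth_fun (R : realType) (n : nat) (M : manifold R n)
  (f : M -> R[i]) : Prop :=
  forall k, smoothC (cimg (atlas M k)) (fun x => f (cinv (atlas M k) x)).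

(* A covariant 2-tensor field, as the family of its component matrices in the
   charts of the atlas; only the values on [cimg (atlas M k)] matter. *)
Definition tensor2 (R : realType) (n : nat) (M : manifold R n) : Type :=
  mindex M -> 'rV[R]_n -> 'M[R]_n.

(* h_ij = (d_i y^a) (d_j y^b) h'_ab under x |-> y; the entry (i, a) of the
   library's Jacobian 'J is d_i y^a. *)
Definition covariant (R : realType) (n : nat) (M : manifold R n)
  (h : tensor2 M) : Prop :=
  forall k l x, overlap (atlas M k) (atlas M l) x ->
    let tau := transition (atlas M k) (atlas M l) in
    h k x = 'J tau x *m h l (tau x) *m ('J tau x)^T.

Definition riemannian_metric (R : realType) (n : nat) (M : manifold R n)
  (h : tensor2 M) : Prop :=
  [/\ covariant h,
      forall k, smooth_mx (cimg (atlas M k)) (h k),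
      forall k x, cimg (atlas M k) x -> (h k x)^T = h k x &
      forall k x (v : 'rV[R]_n), cimg (atlas M k) x -> v != 0 ->
        0 < (v *m h k x *m v^T) 0 0].

(** * The product M_+ = [0, eps) x M

   Coordinates on M_+ are row vectors (r, x) with the coordinate r at index 0;
   functions on M_+, or on its interior, are functions R -> M -> R[i] of which
   only the values at 0 <= r < eps, respectively 0 < r < eps, matter. *)

Definition rcoord (R : realType) (n : nat) (z : 'rV[R]_(1 + n)) : R :=
  lsubmx z 0 0.

Definition xcoord (R : realType) (n : nat) (z : 'rV[R]_(1 + n)) : 'rV[R]_n :=
  rsubmx z.

Definition rx (R : realType) (n : nat) (r : R) (x : 'rV[R]_n) :
  'rV[R]_(1 + n) := row_mx r%:M x.

Definition plus_img (R : realType) (n : nat) (M : manifold R n) (eps : R)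
  (k : mindex M) : set 'rV[R]_(1 + n) :=
  [set z | 0 <= rcoord z < eps /\ cimg (atlas M k) (xcoord z)].

Definition plus_int_img (R : realType) (n : nat) (M : manifold R n) (eps : R)
  (k : mindex M) : set 'rV[R]_(1 + n) :=
  [set z | 0 < rcoord z < eps /\ cimg (atlas M k) (xcoord z)].

Definition plus_rep (R : realType) (n : nat) (M : manifold R n)
  (v : R -> M -> R[i]) (k : mindex M) (z : 'rV[R]_(1 + n)) : R[i] :=
  v (rcoord z) (cinv (atlas M k) (xcoord z)).

Definition smooth_plus (R : realType) (n : nat) (M : manifold R n) (eps : R)
  (v : R -> M -> R[i]) : Prop :=
  forall k, smoothC (plus_img eps k) (plus_rep v k).

Definition smooth_plus_int (R : realType) (n : nat) (M : manifold R n)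
  (eps : R) (v : R -> M -> R[i]) : Prop :=
  forall k, smoothC (plus_int_img eps k) (plus_rep v k).

(* Components of a covariant 2-tensor field on M_+ in the coordinates (r, x). *)
Definition plus_tensor2 (R : realType) (n : nat) (M : manifold R n) : Type :=
  mindex M -> 'rV[R]_(1 + n) -> 'M[R]_(1 + n).

(* dr^2 + h_r *)
Definition gbar (R : realType) (n : nat) (M : manifold R n)
  (hr : R -> tensor2 M) : plus_tensor2 M :=
  fun k z => block_mx 1%:M 0 0 (hr (rcoord z) k (xcoord z)).

(* r^-2 (dr^2 + h_r) *)
Definition gplus (R : realType) (n : nat) (M : manifold R n)
  (hr : R -> tensor2 M) : plus_tensor2 M :=
  fun k z => (rcoord z) ^- 2 *: gbar hr k z.

(* The Laplacian of a function is independent of the coordinates, so it is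
   computed at each point in some chart around it. *)
Definition chart_at (R : realType) (n : nat) (M : manifold R n) (p : M) :
  mindex M := projT1 (cid (atlas_cover p)).

Definition Laplacian (R : realType) (n : nat) (M : manifold R n)
  (g : plus_tensor2 M) (v : R -> M -> R[i]) (r : R) (p : M) : R[i] :=
  let k := chart_at p in
  laplace (g k) (plus_rep v k) (rx r (cmap (atlas M k) p)).

(** * Even Poincare metrics in normal form *)

Definition metric_family (R : realType) (n : nat) (M : manifold R n) (eps : R)
  (hr : R -> tensor2 M) : Prop :=
  (forall r, 0 <= r < eps -> riemannian_metric (hr r)) /\
  forall k, smooth_mx (plus_img eps k)
              (fun z => hr (rcoord z) k (xcoord z)).

(* As h_r is smooth up to r = 0, the k-th Taylor coefficient at r = 0 is
   (k!)^-1 times the limit of the k-th derivative as r -> 0+. *)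
Definition even_family (R : realType) (n : nat) (M : manifold R n)
  (hr : R -> tensor2 M) : Prop :=
  forall k x, cimg (atlas M k) x -> forall (i j : 'I_n) (q : nat), odd q ->
    derive1n q (fun s : R => hr s k x i j) r @[r --> 0^'+] --> (0 : R).

Definition einstein_defect (R : realType) (n : nat) (M : manifold R n)
  (hr : R -> tensor2 M) : plus_tensor2 M :=
  fun k z => ricci (gplus hr k) z + n%:R *: gplus hr k z.

(* E = r^q T on the interior, with T smooth up to r = 0 (hence unique). *)
Definition r_multiple (R : realType) (n : nat) (M : manifold R n) (eps : R)
  (q : nat) (E T : plus_tensor2 M) : Prop :=
  forall k, smooth_mx (plus_img eps k) (T k) /\
    forall z, plus_int_img eps k z -> E k z = rcoord z ^+ q *: T k z.

Definition bigO_r (R : realType) (n : nat) (M : manifold R n) (eps : R)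
  (q : nat) (E : plus_tensor2 M) : Prop :=
  exists T : plus_tensor2 M, r_multiple eps q E T.

(* The restriction to r = 0 of the components tangent to M. *)
Definition iota_pullback (R : realType) (n : nat) (M : manifold R n)
  (T : plus_tensor2 M) : tensor2 M :=
  fun k x => drsubmx (T k (rx 0 x)).

Definition even_poincare_normal_form (R : realType) (n : nat)
  (M : manifold R n) (h : tensor2 M) (eps : R) (hr : R -> tensor2 M) : Prop :=
  [/\ metric_family eps hr,
      forall k x, cimg (atlas M k) x -> hr 0 k x = h k x,
      even_family hr &
      if odd n then forall q, bigO_r eps q (einstein_defect hr)
      else exists T : plus_tensor2 M,
        r_multiple eps (n - 2) (einstein_defect hr) T /\
        forall k x, cimg (atlas M k) x ->
          \tr (invmx (h k x) *m iota_pullback T k x) = 0].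

(** * The shift operator *)

Definition deriv_r (R : realType) (n : nat) (M : manifold R n)
  (v : R -> M -> R[i]) (r : R) (p : M) : R[i] :=
  derive1 (fun s : R => complex.Re (v s p)) r
  +i* derive1 (fun s : R => complex.Im (v s p)) r.

(* tr (h_r^-1 \dot h_r), again independent of the chart. *)
Definition log_trace (R : realType) (n : nat) (M : manifold R n)
  (hr : R -> tensor2 M) (r : R) (p : M) : R :=
  let k := chart_at p in
  let x := cmap (atlas M k) p in
  \tr (invmx (hr r k x) *m \matrix_(i, j) derive1 (fun s : R => hr s k x i j) r).

Definition shift_op (R : realType) (n : nat) (M : manifold R n)
  (hr : R -> tensor2 M) (lambda : R[i]) (v : R -> M -> R[i]) (r : R) (p : M) :
  R[i] :=
  r%:C * Laplacian (gbar hr) v r p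
  - (2 * lambda - n%:R + 1) * deriv_r v r p
  - 2^-1 * (lambda - n%:R + 1) * (log_trace hr r p)%:C * v r p.

(** * Eigenfunctions *)

(* r^z = exp (z ln r), for r > 0. *)
Definition cpow (R : realType) (r : R) (z : R[i]) : R[i] :=
  (r `^ complex.Re z)%:C *
  (cos (complex.Im z * ln r) +i* sin (complex.Im z * ln r)).

Definition has_boundary_value (R : realType) (n : nat) (M : manifold R n)
  (eps : R) (nu : R[i]) (u : R -> M -> R[i]) (f : M -> R[i]) : Prop :=
  exists F G : R -> M -> R[i],
    [/\ smooth_plus eps F, smooth_plus eps G,
        forall r p, 0 < r < eps ->
          u r p = cpow r nu * G r p + cpow r (n%:R - nu) * F r p &
        forall p, f p = F 0 p].

Definition M_u (R : realType) (n : nat) (M : manifold R n)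
  (u : R -> M -> R[i]) (lambda : R[i]) (r : R) (p : M) : R[i] :=
  cpow r (lambda - n%:R + 1) * u r p.

Definition M_r (R : realType) (n : nat) (M : manifold R n)
  (v : R -> M -> R[i]) (r : R) (p : M) : R[i] := r%:C * v r p.

(* Main.v *)
(** Write $\bar g = r^2 g_+ = dr^2 + h_r$, $\mu = \lambda - n + 1$ and
    $T = \operatorname{tr}(h_r^{-1}\dot h_r)$.  The conformal change formula in
    dimension $n + 1$ gives
    $\Delta_{g_+} u = r^2 \Delta_{\bar g} u - (n - 1) r \partial_r u$.  Since
    $\Delta_{\bar g} r = \frac12 T$ and $|dr|_{\bar g} = 1$,
    $\Delta_{\bar g}(r^\mu u) = r^\mu \Delta_{\bar g} u
      + 2 \mu r^{\mu - 1} \partial_r u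
      + (\mu(\mu - 1) r^{\mu - 2} + \frac12 \mu r^{\mu - 1} T) u$.
    In $S(g_+;\lambda)(r^\mu u)$ the terms in $T$ cancel, the terms in
    $\partial_r u$ are absorbed by $\Delta_{g_+}$, and the eigenvalue equation
    leaves $(-\nu(n - \nu) - \mu(\lambda + 1)) r^{\mu - 1} u$, whose coefficient
    is $(\lambda + \nu - n + 1)(\nu - \lambda - 1)$. *)
Require Import Defs.
From mathcomp Require Import all_boot all_order all_algebra.
From mathcomp Require Import all_classical all_reals all_analysis.
From mathcomp Require Import complex ring lra.
Import Order.TTheory GRing.Theory Num.Theory.
Import numFieldNormedType.Exports.
Local Open Scope ring_scope.
Local Open Scope complex_scope.

Set Implicit Arguments.
Unset Strict Implicit.

(** * Derivatives of smooth functions on open sets *)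

Lemma smooth_subset (R : realType) (m : nat) (A B : set 'rV[R]_m)
    (f : 'rV[R]_m -> R) :
  (B `<=` A)%classic -> smooth A f -> smooth B f.
Proof.
move=> BA sf x /BA /sf [W [F [oW Wx sF fF]]].
by exists W, F; split=> // y Wy /BA; exact: fF.
Qed.

(** [smooth] only provides local extensions. On an open set an extension agrees with f on a whole
    neighbourhood of each point, so all their iterated partial derivatives agree there too. *)
Lemma smooth_derivable (R : realType) (m : nat) (A : set 'rV[R]_m)
    (f : 'rV[R]_m -> R) (s : seq 'I_m) (a : 'I_m) (x : 'rV[R]_m) :
  open A -> smooth A f -> A x -> derivable (iter_pd s f) x (delta_mx 0 a).
Proof.
move=> oA sf Ax; have [W [F [oW Wx sF fF]]] := sf x Ax.
have nbhsAW y : W y -> A y -> nbhs y (W `&` A)%classic.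
  by move=> Wy Ay; apply: open_nbhs_nbhs; split; [exact: openI|].
(* The induction on s needs equality at every point of W and A, not only at x, because each further
   derivative sees a neighbourhood. *)
have fFs : forall y, W y -> A y -> iter_pd s f y = iter_pd s F y.
  elim: s => [|b s IHs] y Wy Ay /=; first exact: fF.
  apply: near_eq_derive; apply: filterS (nbhsAW y Wy Ay) => z [Wz Az].
  exact: IHs.
have [_ dF] := sF s x Wx.
apply: near_eq_derivable (dF a).
by apply: filterS (nbhsAW x Wx Ax) => z [Wz Az]; rewrite fFs.
Qed.

Definition derivableC (R : realType) (m : nat) (f : 'rV[R]_m -> R[i])
    (x : 'rV[R]_m) (a : 'I_m) : Prop :=
  derivable (fun y => complex.Re (f y)) x (delta_mx 0 a) /\
  derivable (fun y => complex.Im (f y)) x (delta_mx 0 a).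

Lemma smoothC_derivableC (R : realType) (m : nat) (A : set 'rV[R]_m)
    (f : 'rV[R]_m -> R[i]) (a : 'I_m) (x : 'rV[R]_m) :
  open A -> smoothC A f -> A x -> derivableC f x a.
Proof.
by move=> oA [sR sI] Ax; split;
  [exact: (@smooth_derivable _ _ _ _ [::] a _ oA sR Ax)
  |exact: (@smooth_derivable _ _ _ _ [::] a _ oA sI Ax)].
Qed.

Lemma smoothC_derivableC_pdC (R : realType) (m : nat) (A : set 'rV[R]_m)
    (f : 'rV[R]_m -> R[i]) (a b : 'I_m) (x : 'rV[R]_m) :
  open A -> smoothC A f -> A x -> derivableC (pdC b f) x a.
Proof.
by move=> oA [sR sI] Ax; split;
  [exact: (@smooth_derivable _ _ _ _ [:: b] a _ oA sR Ax)
  |exact: (@smooth_derivable _ _ _ _ [:: b] a _ oA sI Ax)].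
Qed.

(** * Sum and product rules for complex-valued functions *)

Section ComplexCalculus.
Variables (R : realType) (m : nat).
Implicit Types (f g : 'rV[R]_m -> R[i]) (x : 'rV[R]_m) (a : 'I_m).

Lemma near_eq_pdC f g a x :
  (\forall y \near x, f y = g y) -> pdC a f x = pdC a g x.
Proof.
by move=> fg; congr (_ +i* _); apply: near_eq_derive;
  apply: filterS fg => y ->.
Qed.

Lemma ReM (z w : R[i]) : complex.Re (z * w) =
  complex.Re z * complex.Re w - complex.Im z * complex.Im w.
Proof. by case: z w => [? ?] [? ?]. Qed.

Lemma ImM (z w : R[i]) : complex.Im (z * w) =
  complex.Re z * complex.Im w + complex.Im z * complex.Re w.
Proof. by case: z w => [? ?] [? ?]. Qed.

Lemma derivableCM f g x a : derivableC f x a -> derivableC g x a ->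
  derivableC (fun y => f y * g y) x a.
Proof.
move=> [fR fI] [gR gI]; split.
- under eq_fun do rewrite ReM.
  exact: (derivableB (derivableM fR gR) (derivableM fI gI)).
- under eq_fun do rewrite ImM.
  exact: (derivableD (derivableM fR gI) (derivableM fI gR)).
Qed.

Lemma pdCM f g x a : derivableC f x a -> derivableC g x a ->
  pdC a (fun y => f y * g y) x = pdC a f x * g x + f x * pdC a g x.
Proof.
move=> [fR fI] [gR gI]; rewrite /pdC /pd.
under [X in 'D__ X _ +i* _]eq_fun do rewrite ReM.
under [X in _ +i* 'D__ X _]eq_fun do rewrite ImM.
rewrite (deriveB (derivableM fR gR) (derivableM fI gI)).
rewrite (deriveD (derivableM fR gI) (derivableM fI gR)).
rewrite (deriveM fR gR) (deriveM fI gI) (deriveM fR gI) (deriveM fI gR).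
move: ('D_ _ _ _) ('D_ _ _ _) ('D_ _ _ _) ('D_ _ _ _) => u v w t.
rewrite /GRing.scale/=; case: (f x) (g x) => [a1 b1] [a2 b2] /=.
by apply/eqP; rewrite eq_complex /=; apply/andP; split; apply/eqP; ring.
Qed.

Lemma pdCD f g x a : derivableC f x a -> derivableC g x a ->
  pdC a (fun y => f y + g y) x = pdC a f x + pdC a g x.
Proof.
move=> [fR fI] [gR gI]; rewrite /pdC /pd.
have ReD (z w : R[i]) : complex.Re (z + w) = complex.Re z + complex.Re w.
  by case: z w => [? ?] [? ?].
have ImD (z w : R[i]) : complex.Im (z + w) = complex.Im z + complex.Im w.
  by case: z w => [? ?] [? ?].
under [X in 'D__ X _ +i* _]eq_fun do rewrite ReD.
under [X in _ +i* 'D__ X _]eq_fun do rewrite ImD.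
by rewrite !deriveD.
Qed.

Lemma laplaceE (G : 'rV[R]_m -> 'M[R]_m) f x :
  laplace G f x = \sum_(a < m) \sum_(b < m) (invmx (G x) a b)%:C *
    (pdC a (pdC b f) x
     - \sum_(c < m) (christoffel G a b c x)%:C * pdC c f x).
Proof. by rewrite /laplace /codiff opprK. Qed.

End ComplexCalculus.

(** * The coordinate r and functions of r alone *)

Section RadialCoordinate.
Variables (R : realType) (n : nat).
Local Notation e0 := (lshift n (ord0 : 'I_1)).
Implicit Types (f : 'rV[R]_(1 + n) -> R) (phi : R -> R) (z : 'rV[R]_(1 + n)).

Lemma rcoordE z : rcoord z = z 0 e0.
Proof. by rewrite /rcoord mxE; congr (z _ _); exact: val_inj. Qed.

Lemma rx_eta z : rx (rcoord z) (xcoord z) = z.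
Proof.
rewrite /rx /rcoord /xcoord -[RHS]hsubmxK; congr row_mx.
by apply/matrixP=> i j; rewrite !ord1 !mxE eqxx.
Qed.

Lemma rx_rcoord (r : R) (x : 'rV[R]_n) : rcoord (rx r x) = r.
Proof. by rewrite /rcoord /rx row_mxKl mxE eqxx mulr1n. Qed.

Lemma rx_xcoord (r : R) (x : 'rV[R]_n) : xcoord (rx r x) = x.
Proof. by rewrite /xcoord /rx row_mxKr. Qed.

Lemma shift_rx (t : R) z :
  t *: delta_mx 0 e0 + z = rx (t + rcoord z) (xcoord z).
Proof.
rewrite -[z in LHS]rx_eta /rx (_ : delta_mx 0 e0 = row_mx 1%:M 0).
  rewrite scale_row_mx add_row_mx scaler0 add0r; congr row_mx.
  by apply/matrixP=> i j; rewrite !ord1 !mxE eqxx !mulr1n mulr1.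
by apply/rowP => j; rewrite !mxE; case: split_ordP => k ->;
  rewrite !mxE ?ord1 ?eqxx// eq_lshift ?eq_rlshift ?eqxx.
Qed.

(** Moving along [e0] changes only r, so the two difference quotients are the same function of t.
    Equality at this level transfers both the existence and the value of the derivative. *)
Lemma growth_rcoord f z :
  (fun t : R => t^-1 *: ((f \o shift z) (t *: delta_mx 0 e0) - f z)) =
  (fun t : R => t^-1 *: (((fun s => f (rx s (xcoord z))) \o shift (rcoord z))
    (t *: (1 : R)) - f (rx (rcoord z) (xcoord z)))).
Proof.
by apply/funext => t; rewrite /= rx_eta shift_rx /GRing.scale/= mulr1.
Qed.

Lemma pd_rcoord f z :
  pd e0 f z = (derive1 (fun s => f (rx s (xcoord z))) (rcoord z)).
Proof. by rewrite derive1E /pd /derive growth_rcoord. Qed.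

Lemma derivable_rcoord f z :
  derivable (fun s => f (rx s (xcoord z))) (rcoord z) 1 ->
  derivable f z (delta_mx 0 e0).
Proof. by rewrite /derivable growth_rcoord. Qed.

(** Along [e0] the function restricts to phi itself; in any other coordinate direction r does not
    move and the difference quotient vanishes identically. *)
Lemma is_derive_radial phi d z (a : 'I_(1 + n)) :
  is_derive (rcoord z) (1 : R) phi d ->
  is_derive z (delta_mx 0 a) (phi \o @rcoord R n) ((a == e0)%:R * d).
Proof.
move=> [dphi vphi]; have [->|ne] := eqVneq a e0.
  apply: DeriveDef.
    apply: derivable_rcoord.
    rewrite (_ : (fun s => _) = phi)//.
    by apply/funext => s /=; rewrite rx_rcoord.
  rewrite -/(pd _ _ _) pd_rcoord mul1r derive1E -vphi; congr ('D_(1 : R) _ _).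
  by apply/funext => s /=; rewrite rx_rcoord.
have cst_growth : (fun t : R => t^-1 *: (((phi \o @rcoord R n) \o shift z)
    (t *: delta_mx 0 a) - (phi \o @rcoord R n) z)) = cst 0.
  apply/funext => t /=; rewrite [rcoord (_ + _)]rcoordE !mxE eqxx /=.
  by rewrite eq_sym (negPf ne) mulr0 add0r -rcoordE subrr scaler0.
apply: DeriveDef; first by rewrite /derivable cst_growth; exact: is_cvg_cst.
by rewrite mul0r /derive cst_growth; exact: lim_cst.
Qed.

End RadialCoordinate.

(** * Complex powers of a positive real and their derivatives *)

Section ComplexPower.
Variable R : realType.
Implicit Types (z w : R[i]) (r s : R).

Lemma cpowD r z w : 0 < r -> cpow r (z + w) = cpow r z * cpow r w.
Proof.
case: z w => [a b] [c d] r0; rewrite /cpow /=.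
rewrite (@powRD _ r a c) ?(gt_eqF r0) ?implybT//.
rewrite mulrDl cosD sinD /=; apply/eqP; rewrite eq_complex /=.
by apply/andP; split; apply/eqP; ring.
Qed.

Lemma powRB1 (a r : R) : 0 < r -> r `^ a = r * r `^ (a - 1).
Proof.
move=> r0; rewrite -[X in X * _](powRr1 (ltW r0)).
by rewrite -powRD ?(gt_eqF r0) ?implybT// addrC subrK.
Qed.

Lemma cpow1 r : 0 < r -> cpow r 1 = r%:C.
Proof.
move=> r0; rewrite /cpow /= mul0r cos0 sin0 powRr1 ?ltW//.
by rewrite -[1 +i* 0]/(1 : R[i]) mulr1.
Qed.

(** Serves to express neighbouring powers through the lowest one, so that a final identity becomes
    polynomial in r. *)
Lemma cpowB1 r z : 0 < r -> cpow r z = r%:C * cpow r (z - 1).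
Proof. by move=> r0; rewrite -[in RHS](cpow1 r0) -cpowD// addrC subrK. Qed.

(** With z = a + ib the real part is s^a cos(b ln s), to which the real product and chain rules
    apply. *)
Lemma is_derive_cpow_Re r z : 0 < r ->
  is_derive r (1 : R) (fun s => complex.Re (cpow s z))
    (complex.Re (z * cpow r (z - 1))).
Proof.
case: z => a b r0; rewrite /cpow ReM /=.
rewrite (_ : (fun s => _) =
    (fun s => s `^ a) * (cos \o (fun s => b * ln s))); last first.
  by apply/funext => s /=; rewrite mul0r subr0.
have dp := is_derive1_powR a r0.
have dl : is_derive r (1 : R) (fun s : R => b * ln s) (b * r^-1).
  have := is_derive1_ln r0 => ?.
  by apply: is_derive_eq; rewrite ?scaler0 ?addr0.
have dc := is_derive1_comp (is_derive_cos _) dl.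
apply: is_derive_eq; rewrite /GRing.scale/=.
(* The factor 1/r from the derivative of ln is absorbed by writing r^a = r r^(a-1). *)
rewrite (powRB1 a r0) oppr0 !addr0; field; lra.
Qed.

Lemma is_derive_cpow_Im r z : 0 < r ->
  is_derive r (1 : R) (fun s => complex.Im (cpow s z))
    (complex.Im (z * cpow r (z - 1))).
Proof.
case: z => a b r0; rewrite /cpow ImM /=.
rewrite (_ : (fun s => _) =
    (fun s => s `^ a) * (sin \o (fun s => b * ln s))); last first.
  by apply/funext => s /=; rewrite mul0r addr0.
have dp := is_derive1_powR a r0.
have dl : is_derive r (1 : R) (fun s : R => b * ln s) (b * r^-1).
  have := is_derive1_ln r0 => ?.
  by apply: is_derive_eq; rewrite ?scaler0 ?addr0.
have dc := is_derive1_comp (is_derive_sin _) dl.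
apply: is_derive_eq; rewrite /GRing.scale/=.
rewrite (powRB1 a r0) oppr0 !addr0; field; lra.
Qed.

End ComplexPower.

(** * The Laplacian of r^mu f for a metric in normal form *)

Section RadialLaplacian.
Variables (R : realType) (n : nat).
Local Notation e0 := (lshift n (ord0 : 'I_1)).
Implicit Types (z : 'rV[R]_(1 + n)) (mu : R[i]).

Lemma sum_delta (A : pzRingType) (I : finType) (i0 : I) (F : I -> A) :
  \sum_i (i == i0)%:R * F i = F i0.
Proof.
rewrite (bigD1 i0)//= eqxx mul1r big1 ?addr0// => i /negPf ->.
by rewrite mul0r.
Qed.

(** Shared bookkeeping for the product rule and the conformal change. V stands for an inverse metric
    with |dr| = 1 and dr orthogonal to the other coordinate differentials; L is the Laplacian
    summand, D a correction to be traced, and the two mixed terms merge into twice the radial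
    derivative. *)
Lemma sum_normal (A : comPzRingType) (I : finType) (i0 : I)
    (V L D : I -> I -> A) (p : I -> A) (w0 w1 w2 w3 : A) :
  (forall a, V a i0 = (a == i0)%:R) -> (forall a, V i0 a = (a == i0)%:R) ->
  \sum_a \sum_b ((a == i0)%:R * ((b == i0)%:R * (V a b * w2))
    + (b == i0)%:R * (V a b * (w1 * p a))
    + (a == i0)%:R * (V a b * (w1 * p b)) + w0 * L a b + w3 * D a b) =
  w2 + 2 * w1 * p i0 + w0 * (\sum_a \sum_b L a b)
    + w3 * (\sum_a \sum_b D a b).
Proof.
move=> V0r V0l; under eq_bigr => a _.
  rewrite big_split big_split big_split big_split /=.
  rewrite -!mulr_sumr !sum_delta; over.
rewrite big_split big_split big_split big_split /= -!mulr_sumr !sum_delta.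
under [X in _ + X + _ + _ + _]eq_bigr do rewrite V0r.
under [X in _ + _ + X + _ + _]eq_bigr do rewrite V0l.
by rewrite !sum_delta V0r eqxx mul1r; ring.
Qed.

Lemma continuous_rcoord : continuous (@rcoord R n).
Proof.
rewrite (_ : @rcoord R n = (fun z => z 0 e0)); last first.
  by apply/funext => z; rewrite rcoordE.
exact: coord_continuous.
Qed.

Lemma near_rcoord_gt0 z : 0 < rcoord z -> \forall y \near z, 0 < rcoord y.
Proof. by move=> z0; exact: (cvgr_gt _ (@continuous_rcoord z) _ z0). Qed.

Lemma derivableC_cpow mu z (a : 'I_(1 + n)) : 0 < rcoord z ->
  derivableC (fun y => cpow (rcoord y) mu) z a.
Proof.
move=> z0; split.
- by have [] := is_derive_radial a (is_derive_cpow_Re mu z0).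
- by have [] := is_derive_radial a (is_derive_cpow_Im mu z0).
Qed.

Lemma pdC_cpow mu z (a : 'I_(1 + n)) : 0 < rcoord z ->
  pdC a (fun y => cpow (rcoord y) mu) z =
  (a == e0)%:R * (mu * cpow (rcoord z) (mu - 1)).
Proof.
move=> z0; rewrite /pdC /pd.
have [_ vR] := is_derive_radial a (is_derive_cpow_Re mu z0).
have [_ vI] := is_derive_radial a (is_derive_cpow_Im mu z0).
rewrite [X in X +i* _]vR [X in _ +i* X]vI.
by case: (a == e0); rewrite ?mul1r ?mul0r//; case: (mu * _).
Qed.

Lemma derivableC_cst (c : R[i]) z (a : 'I_(1 + n)) :
  derivableC (fun=> c) z a.
Proof. by split; exact: derivable_cst. Qed.

Lemma pdC_cst (c : R[i]) z (a : 'I_(1 + n)) : pdC a (fun=> c) z = 0.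
Proof.
by rewrite /pdC /pd !derive_cst.
Qed.

Lemma pdCZ (c : R[i]) (g : 'rV[R]_(1 + n) -> R[i]) z (a : 'I_(1 + n)) :
  derivableC g z a -> pdC a (fun y => c * g y) z = c * pdC a g z.
Proof.
move=> dg; rewrite (pdCM (derivableC_cst c z a) dg).
by rewrite pdC_cst mul0r add0r.
Qed.

Lemma derivableCZ (c : R[i]) (g : 'rV[R]_(1 + n) -> R[i]) z (a : 'I_(1 + n)) :
  derivableC g z a -> derivableC (fun y => c * g y) z a.
Proof. exact: derivableCM (derivableC_cst c z a). Qed.

Lemma pdC2_cpowM mu (f : 'rV[R]_(1 + n) -> R[i]) z (a b : 'I_(1 + n)) :
  0 < rcoord z ->
  (\forall y \near z, forall c, derivableC f y c) ->
  derivableC (pdC b f) z a ->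
  pdC a (pdC b (fun y => cpow (rcoord y) mu * f y)) z =
  (a == e0)%:R * ((b == e0)%:R *
    (mu * (mu - 1) * cpow (rcoord z) (mu - 1 - 1) * f z))
  + (b == e0)%:R * (mu * cpow (rcoord z) (mu - 1) * pdC a f z)
  + (a == e0)%:R * (mu * cpow (rcoord z) (mu - 1) * pdC b f z)
  + cpow (rcoord z) mu * pdC a (pdC b f) z.
Proof.
move=> z0 df d2f.
have dfz c : derivableC f z c by exact: (nbhs_singleton df).
have dW nu := derivableC_cpow nu a z0.
(* The first-order product rule must hold on a neighbourhood of z before it can be differentiated
   again; there r stays positive. *)
rewrite (@near_eq_pdC _ _ _ (fun y => (b == e0)%:R * mu *
    (cpow (rcoord y) (mu - 1) * f y) + cpow (rcoord y) mu * pdC b f y)).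
  rewrite pdCD; last 2 first.
  - exact: derivableCZ (derivableCM (dW _) (dfz a)).
  - exact: derivableCM (dW _) d2f.
  rewrite (pdCZ _ (derivableCM (dW _) (dfz a))).
  rewrite (pdCM (dW _) (dfz a)) (pdCM (dW _) d2f) !pdC_cpow//; ring.
near=> y.
have y0 : 0 < rcoord y by near: y; exact: near_rcoord_gt0.
have dfy : forall c, derivableC f y c by near: y.
rewrite (pdCM (derivableC_cpow mu b y0) (dfy b)).
by rewrite pdC_cpow// !mulrA.
Unshelve. all: by end_near. Qed.

Section NormalForm.
Variables (G : 'rV[R]_(1 + n) -> 'M[R]_(1 + n)) (z : 'rV[R]_(1 + n)).
Hypotheses (z0 : 0 < rcoord z)
  (G0r : forall y a, G y a e0 = (a == e0)%:R)
  (GV0r : forall a, invmx (G z) a e0 = (a == e0)%:R)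
  (GV0l : forall a, invmx (G z) e0 a = (a == e0)%:R).

(** The components [G y a e0] are constant, so of the three derivatives in the Christoffel symbol
    only the radial one survives. Its trace is the source of the term Delta r = T/2. *)
Lemma christoffel_normal (a b : 'I_(1 + n)) :
  christoffel G a b e0 z = - (2^-1 * pd e0 (fun y => G y a b) z).
Proof.
rewrite /christoffel; under eq_bigr do rewrite GV0l.
rewrite sum_delta /pd.
under [X in 'D__ X _ + _ - _]eq_fun do rewrite G0r.
under [X in _ + 'D__ X _ - _]eq_fun do rewrite G0r.
by rewrite !derive_cst !add0r mulrN.
Qed.

(** Product rule for the Laplacian: |dr| = 1 gives the coefficient of the second derivative of r^mu,
    the gradient pairing reduces to the radial derivative of f, and [christoffel_normal] gives the
    trace term. *)
Lemma laplace_cpowM mu (f : 'rV[R]_(1 + n) -> R[i]) :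
  (\forall y \near z, forall c, derivableC f y c) ->
  (forall a b, derivableC (pdC b f) z a) ->
  laplace G (fun y => cpow (rcoord y) mu * f y) z =
  cpow (rcoord z) mu * laplace G f z
  + 2 * (mu * cpow (rcoord z) (mu - 1)) * pdC e0 f z
  + mu * (mu - 1) * cpow (rcoord z) (mu - 1 - 1) * f z
  + 2^-1 * (mu * cpow (rcoord z) (mu - 1) * f z) *
    (\sum_a \sum_b invmx (G z) a b * pd e0 (fun y => G y a b) z)%:C.
Proof.
move=> df d2f; have dfz c : derivableC f z c by exact: (nbhs_singleton df).
set W := cpow (rcoord z) mu; set W1 := mu * cpow _ _; set W2 := _ * cpow _ _.
pose GV a b : R[i] := (invmx (G z) a b)%:C.
have summand a b : GV a b *
    (pdC a (pdC b (fun y => cpow (rcoord y) mu * f y)) z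
     - \sum_c (christoffel G a b c z)%:C *
         pdC c (fun y => cpow (rcoord y) mu * f y) z) =
    (a == e0)%:R * ((b == e0)%:R * (GV a b * (W2 * f z)))
    + (b == e0)%:R * (GV a b * (W1 * pdC a f z))
    + (a == e0)%:R * (GV a b * (W1 * pdC b f z))
    + W * (GV a b * (pdC a (pdC b f) z
         - \sum_c (christoffel G a b c z)%:C * pdC c f z))
    + 2^-1 * (W1 * f z) *
        (invmx (G z) a b * pd e0 (fun y => G y a b) z)%:C.
  rewrite pdC2_cpowM//.
  have -> : \sum_c (christoffel G a b c z)%:C *
      pdC c (fun y => cpow (rcoord y) mu * f y) z =
      W * (\sum_c (christoffel G a b c z)%:C * pdC c f z)
      - 2^-1 * (W1 * f z) * (pd e0 (fun y => G y a b) z)%:C.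
    (* Only c = [e0] differentiates the power of r, so of all Christoffel symbols only those with
       upper index [e0] multiply f itself. *)
    transitivity (\sum_c (W * ((christoffel G a b c z)%:C * pdC c f z)
        + (c == e0)%:R * ((christoffel G a b c z)%:C * (W1 * f z)))).
      apply: eq_bigr => c _; rewrite (pdCM (derivableC_cpow mu c z0) (dfz c)).
      by rewrite pdC_cpow// -/W1 -/W; ring.
    rewrite big_split /= -mulr_sumr sum_delta christoffel_normal.
    rewrite rmorphN rmorphM fmorphV rmorph_nat; ring.
  rewrite -/W -/W1 -/W2 rmorphM -/(GV a b); ring.
rewrite !laplaceE.
transitivity (\sum_a \sum_b (
    (a == e0)%:R * ((b == e0)%:R * (GV a b * (W2 * f z)))
    + (b == e0)%:R * (GV a b * (W1 * pdC a f z))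
    + (a == e0)%:R * (GV a b * (W1 * pdC b f z))
    + W * (GV a b * (pdC a (pdC b f) z
         - \sum_c (christoffel G a b c z)%:C * pdC c f z))
    + 2^-1 * (W1 * f z) *
        (invmx (G z) a b * pd e0 (fun y => G y a b) z)%:C)).
  by apply: eq_bigr => a _; apply: eq_bigr => b _; exact: summand.
rewrite (@sum_normal _ _ _ GV (fun a b => GV a b * (pdC a (pdC b f) z
         - \sum_c (christoffel G a b c z)%:C * pdC c f z))
    (fun a b => (invmx (G z) a b * pd e0 (fun y => G y a b) z)%:C)
    (fun a => pdC a f z)).
- rewrite [X in _ = _ + _ * X](_ : _ = \sum_a \sum_b
      (invmx (G z) a b * pd e0 (fun y => G y a b) z)%:C); last first.
    by rewrite rmorph_sum; apply: eq_bigr => a _; rewrite rmorph_sum.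
  by rewrite /GV; ring.
- by move=> a; rewrite /GV GV0r rmorph_nat.
- by move=> a; rewrite /GV GV0l rmorph_nat.
Qed.

End NormalForm.

(** * Conformal change from G to r^-2 G *)

Section ConformalChange.
Variables (G : 'rV[R]_(1 + n) -> 'M[R]_(1 + n)) (z : 'rV[R]_(1 + n)).
Hypotheses (z0 : 0 < rcoord z) (Gunit : G z \in unitmx)
  (Gsym : (G z)^T = G z)
  (dG : forall a b c, derivable (fun y => G y b c) z (delta_mx 0 a)).
Local Notation r := (rcoord z).
Let Gplus (y : 'rV[R]_(1 + n)) := rcoord y ^- 2 *: G y.

Lemma pd_conformal (a b c : 'I_(1 + n)) :
  pd a (fun y => Gplus y b c) z =
  r ^- 2 * (pd a (fun y => G y b c) z - 2 * r^-1 * ((a == e0)%:R * G z b c)).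
Proof.
have rn0 : r != 0 by rewrite gt_eqF.
have dr : is_derive r (1 : R) (fun s : R => s ^- 2) (- 2 * r ^- 3).
  have dsqr : is_derive r (1 : R) (fun s : R => s ^+ 2) (2 * r).
    have dX := is_deriveX 2 (is_derive_id r (1 : R)).
    by apply: is_derive_eq; rewrite /GRing.scale/= mulr1.
  have dV := @is_deriveV R (fun s => s ^+ 2) r _ _ (expf_neq0 2 rn0) dsqr.
  by apply: is_derive_eq; rewrite /GRing.scale/=; field.
have [dw vw] := is_derive_radial a dr.
rewrite (_ : (fun y => _) =
  ((fun s : R => s ^- 2) \o @rcoord R n) * (fun y => G y b c)); last first.
  by apply/funext => y; rewrite /Gplus mxE.
by rewrite /pd (deriveM dw (@dG a b c)) vw /GRing.scale/=; field.
Qed.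

Lemma mulmx_invE (b c : 'I_(1 + n)) :
  \sum_d invmx (G z) c d * G z b d = (b == c)%:R.
Proof.
have := mulVmx Gunit => /matrixP /(_ c b); rewrite !mxE eq_sym => <-.
by apply: eq_bigr => d _; congr (_ * _); rewrite -[in LHS]Gsym mxE.
Qed.

(** The usual formula for a factor e^(2w) with w = - ln r, whose differential is - r^-1 dr. *)
Lemma christoffel_conformal (a b c : 'I_(1 + n)) :
  christoffel Gplus a b c z = christoffel G a b c z
  - r^-1 * ((a == e0)%:R * (b == c)%:R + (b == e0)%:R * (a == c)%:R
            - invmx (G z) c e0 * G z a b).
Proof.
have rn0 : r != 0 by rewrite gt_eqF.
rewrite /christoffel /Gplus invmxZ; last first.
  by rewrite unitmxZ// unitfE invr_eq0 expf_neq0.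
(* The derivative of r^-2 contributes three terms: in two of them contracting G with its inverse
   gives a Kronecker delta, and in the third the index d is forced to be [e0]. *)
transitivity (2^-1 * \sum_d (invmx (G z) c d *
      (pd a (fun y => G y b d) z + pd b (fun y => G y a d) z
       - pd d (fun y => G y a b) z)
    + - 2 * r^-1 * ((a == e0)%:R * (invmx (G z) c d * G z b d))
    + - 2 * r^-1 * ((b == e0)%:R * (invmx (G z) c d * G z a d))
    + (d == e0)%:R * (2 * r^-1 * (invmx (G z) c d * G z a b)))).
  congr (_ * _); apply: eq_bigr => d _.
  by rewrite -/Gplus !pd_conformal mxE invrK; field.
by rewrite !big_split/= -!mulr_sumr !mulmx_invE sum_delta; field.
Qed.

(** The inverse metric scales by r^2. Tracing the correction to the Christoffel symbols gives 2 - (n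
    + 1) = -(n - 1) times r times the radial derivative. *)
Lemma laplace_conformal (f : 'rV[R]_(1 + n) -> R[i])
    (GV0r : forall a, invmx (G z) a e0 = (a == e0)%:R)
    (GV0l : forall a, invmx (G z) e0 a = (a == e0)%:R) :
  laplace Gplus f z =
  r%:C ^+ 2 * laplace G f z - (n%:R - 1) * r%:C * pdC e0 f z.
Proof.
have rn0 : r != 0 by rewrite gt_eqF.
have rCn0 : r%:C != 0 by rewrite fmorph_eq0.
rewrite !laplaceE {1}/Gplus invmxZ; last first.
  by rewrite unitmxZ// unitfE invr_eq0 expf_neq0.
pose GV a b : R[i] := (invmx (G z) a b)%:C.
(* The 0 fills the slot of [sum_normal] for a term of order zero in f, which a conformal change does
   not produce. *)
transitivity (\sum_a \sum_b ((a == e0)%:R * ((b == e0)%:R * (GV a b * 0))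
    + (b == e0)%:R * (GV a b * (r%:C * pdC a f z))
    + (a == e0)%:R * (GV a b * (r%:C * pdC b f z))
    + r%:C ^+ 2 * (GV a b * (pdC a (pdC b f) z
         - \sum_c (christoffel G a b c z)%:C * pdC c f z))
    + - (r%:C * pdC e0 f z) * (invmx (G z) a b * G z a b)%:C)).
  apply: eq_bigr => a _; apply: eq_bigr => b _.
  rewrite mxE rmorphM -/(GV a b) invrK rmorphXn.
  have -> : \sum_c (christoffel Gplus a b c z)%:C * pdC c f z =
      \sum_c (christoffel G a b c z)%:C * pdC c f z
      - r%:C^-1 * ((a == e0)%:R * pdC b f z + (b == e0)%:R * pdC a f z
                   - (G z a b)%:C * pdC e0 f z).
    transitivity (\sum_c ((christoffel G a b c z)%:C * pdC c f z
      + (c == b)%:R * (- r%:C^-1 * ((a == e0)%:R * pdC c f z))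
      + (c == a)%:R * (- r%:C^-1 * ((b == e0)%:R * pdC c f z))
      + (c == e0)%:R * (r%:C^-1 * ((G z a b)%:C * pdC c f z)))).
      apply: eq_bigr => c _; rewrite christoffel_conformal GV0r.
      move: (christoffel G a b c z) => Gamma.
      rewrite !(rmorphB, rmorphD, rmorphM) fmorphV !rmorph_nat /=.
      by rewrite ![_ == c]eq_sym; ring.
    rewrite !big_split/= !sum_delta; ring.
  by rewrite rmorphM -/(GV a b); field.
rewrite (@sum_normal _ _ _ GV (fun a b => GV a b * (pdC a (pdC b f) z
         - \sum_c (christoffel G a b c z)%:C * pdC c f z))
    (fun a b => (invmx (G z) a b * G z a b)%:C)
    (fun a => pdC a f z)); last 2 first.
- by move=> a; rewrite /GV GV0r rmorph_nat.
- by move=> a; rewrite /GV GV0l rmorph_nat.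
(* The trace of G^-1 G is the dimension of M_+. *)
have -> : \sum_a \sum_b (invmx (G z) a b * G z a b)%:C = 1 + n%:R.
  under eq_bigr do rewrite -rmorph_sum mulmx_invE eqxx rmorph1.
  by rewrite sumr_const card_ord natrD.
by rewrite /GV; ring.
Qed.

End ConformalChange.
End RadialLaplacian.

(** * The metric dr^2 + h_r in the charts of M_+ *)

Section NormalFormMetric.
Variables (R : realType) (n : nat) (M : manifold R n).
Local Notation e0 := (lshift n (ord0 : 'I_1)).
Implicit Types (eps : R) (h : tensor2 M) (hr : R -> tensor2 M)
  (z : 'rV[R]_(1 + n)) (k : mindex M).

Lemma open_plus_int_img eps k : open (@plus_int_img R n M eps k).
Proof.
have -> : @plus_int_img R n M eps k = ((@rcoord R n @^-1` `]0, eps[) `&`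
    (@xcoord R n @^-1` cimg (atlas M k)))%classic.
  by apply/seteqP; split => z /=; rewrite in_itv.
apply: openI.
- by apply: open_comp;
    [move=> z _; exact: continuous_rcoord|exact: interval_open].
- by apply: open_comp;
    [move=> z _; exact: continuous_rsubmx|exact: cimg_open].
Qed.

Lemma plus_int_imgS eps k :
  (@plus_int_img R n M eps k `<=` @plus_img R n M eps k)%classic.
Proof. by move=> z [/andP[/ltW z0 ze] zx]; split=> //; apply/andP. Qed.

(** A vector v in the left kernel satisfies v h v^T = 0, so positivity forces v = 0. *)
Lemma riemannian_metric_unit h k (x : 'rV[R]_n) :
  riemannian_metric h -> cimg (atlas M k) x -> h k x \in unitmx.
Proof.
case=> _ _ _ hpos kx; rewrite -row_free_unit -kermx_eq0.
apply/rowV0P => v /sub_kermxP vh; apply/eqP/negPn/negP => v0.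
by have := hpos k x v kx v0; rewrite vh mul0mx mxE ltxx.
Qed.

Lemma gbar0r hr k z a : gbar hr k z a e0 = (a == e0)%:R.
Proof.
rewrite /gbar; case: (split_ordP a) => i ->.
- by rewrite block_mxEul !mxE eq_lshift.
- by rewrite block_mxEdl mxE eq_rlshift.
Qed.

Lemma gbar0l hr k z a : gbar hr k z e0 a = (a == e0)%:R.
Proof.
rewrite /gbar; case: (split_ordP a) => i ->.
- by rewrite block_mxEul !mxE eq_lshift eq_sym.
- by rewrite block_mxEur mxE eq_rlshift.
Qed.

Section Point.
Variables (hr : R -> tensor2 M) (k : mindex M) (z : 'rV[R]_(1 + n)).
Hypotheses (hz : riemannian_metric (hr (rcoord z)))
  (kz : cimg (atlas M k) (xcoord z)).

Lemma gbar_unit : gbar hr k z \in unitmx.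
Proof.
by rewrite unitmxE /gbar det_lblock det1 mul1r -unitmxE riemannian_metric_unit.
Qed.

Lemma gbar_sym : (gbar hr k z)^T = gbar hr k z.
Proof.
have [_ _ hsym _] := hz.
by rewrite /gbar tr_block_mx trmx1 !trmx0 hsym.
Qed.

Lemma invmx_gbar : invmx (gbar hr k z) =
  block_mx 1%:M 0 0 (invmx (hr (rcoord z) k (xcoord z))).
Proof. by rewrite /gbar invmx_block_diag ?invmx1//; exact: gbar_unit. Qed.

Lemma invmx_gbar0r a : invmx (gbar hr k z) a e0 = (a == e0)%:R.
Proof.
rewrite invmx_gbar; case: (split_ordP a) => i ->.
- by rewrite block_mxEul !mxE eq_lshift.
- by rewrite block_mxEdl mxE eq_rlshift.
Qed.

Lemma invmx_gbar0l a : invmx (gbar hr k z) e0 a = (a == e0)%:R.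
Proof.
rewrite invmx_gbar; case: (split_ordP a) => i ->.
- by rewrite block_mxEul !mxE eq_lshift eq_sym.
- by rewrite block_mxEur mxE eq_rlshift.
Qed.

(** The row and column of dr are constant, so only the block h_r contributes; the symmetry of its
    inverse turns the double sum into a trace. *)
Lemma trace_dr_gbar :
  \sum_a \sum_b invmx (gbar hr k z) a b * pd e0 (fun y => gbar hr k y a b) z =
  \tr (invmx (hr (rcoord z) k (xcoord z)) *m
       \matrix_(i, j) derive1 (fun s => hr s k (xcoord z) i j) (rcoord z)).
Proof.
have [_ _ hsym _] := hz.
have pd0 a b (c : R) : (forall y, gbar hr k y a b = c) ->
    pd e0 (fun y => gbar hr k y a b) z = 0.
  by move=> gc; rewrite /pd; under eq_fun do rewrite gc; exact: derive_cst.
rewrite big_split_ord /= big_ord1 big1 ?add0r; last first.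
  by move=> b _; rewrite (pd0 _ _ _ (fun y => gbar0l hr k y b)) mulr0.
transitivity (\sum_(i < n) \sum_(j < n)
    invmx (hr (rcoord z) k (xcoord z)) i j *
    derive1 (fun s => hr s k (xcoord z) i j) (rcoord z)).
  apply: eq_bigr => i _; rewrite big_split_ord /= big_ord1.
  rewrite (pd0 _ _ _ (fun y => gbar0r hr k y _)) mulr0 add0r.
  apply: eq_bigr => j _; rewrite invmx_gbar block_mxEdr pd_rcoord.
  congr (_ * _); apply: (congr1 (fun g : R -> R => derive1 g (rcoord z))).
  apply/funext => s.
  by rewrite /gbar block_mxEdr rx_rcoord rx_xcoord.
rewrite /mxtrace exchange_big /=; apply: eq_bigr => i _; rewrite mxE.
apply: eq_bigr => j _; rewrite mxE; congr (_ * _).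
by rewrite -[in LHS](hsym k _ kz) -trmx_inv mxE.
Qed.

End Point.

(** Entries in the row or column of dr are constant. For the block h_r, smoothness up to r = 0 is
    restricted to the interior, which is open. *)
Lemma derivable_gbar eps hr k z (a b c : 'I_(1 + n)) :
  metric_family eps hr -> plus_int_img eps k z ->
  derivable (fun y => gbar hr k y b c) z (delta_mx 0 a).
Proof.
move=> [_ shr] kz.
case: (split_ordP c) => j ->.
  rewrite ord1; under eq_fun do rewrite gbar0r; exact: derivable_cst.
case: (split_ordP b) => i ->.
  rewrite ord1; under eq_fun do rewrite gbar0l; exact: derivable_cst.
under eq_fun do rewrite /gbar block_mxEdr.
have shrk := smooth_subset (@plus_int_imgS eps k) (shr k i j).
exact: (@smooth_derivable _ _ _ _ [::] a _ (@open_plus_int_img eps k) shrk kz).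
Qed.

Lemma pdC_plus_rep (v : R -> M -> R[i]) k (r : R) (p : M) :
  cdom (atlas M k) p ->
  pdC e0 (plus_rep v k) (rx r (cmap (atlas M k) p)) = deriv_r v r p.
Proof.
move=> kp; rewrite /pdC /deriv_r !pd_rcoord rx_rcoord rx_xcoord.
congr (_ +i* _); apply: (congr1 (fun g : R -> R => derive1 g r));
  by apply/funext => s; rewrite /plus_rep rx_rcoord rx_xcoord cmapK.
Qed.

End NormalFormMetric.

(** * The two identities for r^mu u, computed in one chart *)

Theorem theorem3p7 (R : realType) (n : nat) (M : manifold R n)
    (h : tensor2 M) (eps : R) (hr : R -> tensor2 M)
    (nu : R[i]) (u : R -> M -> R[i]) (f : M -> R[i]) :
  (3 <= n)%N ->
  riemannian_metric h ->
  0 < eps ->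
  even_poincare_normal_form h eps hr ->
  complex.Re nu = n%:R / 2 ->
  nu <> n%:R / 2 ->
  smooth_plus_int eps u ->
  (forall r p, 0 < r < eps ->
     Laplacian (gplus hr) u r p + nu * (n%:R - nu) * u r p = 0) ->
  smooth_fun f ->
  has_boundary_value eps nu u f ->
  forall (lambda : R[i]) (r : R) (p : M), 0 < r < eps ->
    M_r (M_u u lambda) r p = M_u u (lambda + 1) r p /\
    shift_op hr lambda (M_u u lambda) r p =
      (lambda + nu - n%:R + 1) * (nu - lambda - 1) * M_u u (lambda - 1) r p.
Proof.
move=> _ _ _ [mf _ _ _] _ _ su eigen _ _ lambda r p reps.
have /andP[r0 re] := reps.
split.
  rewrite /M_r /M_u (_ : lambda + 1 - n%:R + 1 = lambda - n%:R + 1 + 1).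
    by rewrite (cpowB1 (_ + 1 + 1) r0) addrK mulrA.
  by ring.
set k := chart_at p; set x := cmap (atlas M k) p.
have kp : cdom (atlas M k) p by exact: (projT2 (cid (atlas_cover p))).
pose z : 'rV[R]_(1 + n) := rx r x.
have rz : rcoord z = r by exact: rx_rcoord.
have xz : xcoord z = x by exact: rx_xcoord.
have kx : cimg (atlas M k) x by exists p.
have kz : plus_int_img eps k z by rewrite /plus_int_img /= rz xz.
have z0 : 0 < rcoord z by rewrite rz.
have hz : riemannian_metric (hr (rcoord z)).
  by apply: mf.1; rewrite rz (ltW r0).
have kxz : cimg (atlas M k) (xcoord z) by rewrite xz.
have oW := @open_plus_int_img R n M eps k.
(* The eigenfunction is differentiated twice, hence derivability near z and not just at z. *)
have du : \forall y \near z, forall c, derivableC (plus_rep u k) y c.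
  apply: filterS (open_nbhs_nbhs (conj oW kz)) => y ky c.
  exact: smoothC_derivableC oW (su k) ky.
have d2u a b : derivableC (pdC b (plus_rep u k)) z a.
  exact: smoothC_derivableC_pdC oW (su k) kz.
have dg a b c := @derivable_gbar R n M eps hr k z a b c mf kz.
have GV0r := invmx_gbar0r hz kxz.
have GV0l := invmx_gbar0l hz kxz.
pose mu := lambda - n%:R + 1.
have uz : plus_rep u k z = u r p by rewrite /plus_rep rz xz cmapK.
have repM : plus_rep (M_u u lambda) k =
    (fun y => cpow (rcoord y) mu * plus_rep u k y) by [].
have derMu : deriv_r (M_u u lambda) r p =
    mu * cpow r (mu - 1) * u r p + cpow r mu * deriv_r u r p.
  rewrite -!(pdC_plus_rep _ _ kp) repM -/x -/z.
  rewrite (pdCM (derivableC_cpow mu _ z0) (nbhs_singleton du _)).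
  by rewrite pdC_cpow// eqxx mul1r uz rz.
have LMu := laplace_cpowM z0 (gbar0r hr k) GV0r GV0l mu du d2u.
have Lconf := laplace_conformal z0 (gbar_unit hz kxz) (gbar_sym hz kxz) dg
  (plus_rep u k) GV0r GV0l.
have := eigen r p reps.
rewrite /shift_op /Laplacian /log_trace -/k -/x -/z repM LMu.
rewrite (trace_dr_gbar hz kxz) derMu.
(* Unfolding [gplus] exposes the conformal factor in the form expected by [Lconf]. *)
rewrite -[gplus hr k]/(fun y => rcoord y ^- 2 *: gbar hr k y) Lconf.
rewrite uz rz xz {LMu Lconf} (pdC_plus_rep u r kp).
have rC0 : r%:C != 0 by rewrite fmorph_eq0 gt_eqF.
have -> : M_u u (lambda - 1) r p = cpow r (mu - 1) * u r p.
  by rewrite /M_u /mu; congr (cpow _ _ * _); ring.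
have -> : M_u u lambda r p = r%:C * cpow r (mu - 1) * u r p.
  by rewrite /M_u -/mu (cpowB1 mu r0).
(* All powers are reduced to W = r^(mu-2), after which the analytic quantities are generalized and
   the goal is purely algebraic. *)
rewrite (cpowB1 mu r0) (cpowB1 (mu - 1) r0).
move: (laplace _ _ _) (deriv_r u r p) (u r p) (cpow r (mu - 1 - 1))
  (\tr _)%:C => L D U W T eig.
have -> : lambda = mu + n%:R - 1 by rewrite /mu; ring.
(* The eigenvalue equation, solved for r^2 times the Laplacian of dr^2 + h_r applied to u. *)
have eqL : r%:C ^+ 2 * L =
    (n%:R - 1) * r%:C * D - nu * (n%:R - nu) * U.
  by apply/eqP; rewrite -subr_eq0 -[X in _ == X]eig; apply/eqP; ring.
apply/eqP; rewrite -subr_eq0; apply/eqP.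
(* The two sides differ by r^(mu-1) times the defect in the eigenvalue equation: the shift operator
   contributes r r^mu L = W r (r^2 L), which fixes the factor. *)
transitivity (W * (r%:C ^+ 2 * L
    - ((n%:R - 1) * r%:C * D - nu * (n%:R - nu) * U)) * r%:C).
  by field.
by rewrite eqL subrr mulr0 mul0r.
Qed.
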